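(* Let $A\in\mathcal{B}(\mathcal{H})$ be a positive operator with $\dim(R(A))\ge 2$, let $T\in\mathcal{B}_{A^{1/2}}(\mathcal{H})$ and let $q\in\mathcal{D}$. Then: (i) $q\,\sigma_{A_p}(T)\subseteq W_{q,A}(T)$; (ii) $q\,\sigma_{A_{app}}(T)\subseteq \overline{W_{q,A}(T)}$, where $\overline{W_{q,A}(T)}$ denotes the closure of $W_{q,A}(T)$ in $\mathbb{C}$; (iii) if $R(A)$ is closed, then $q\,\sigma_A(T)\subseteq \overline{W_{q,A}(T)}$.
   Context: $\mathcal{H}$ is a separable infinite-dimensional complex Hilbert space with inner product $\langle\cdot,\cdot\rangle$ (linear in the first variable); $\mathcal{B}(\mathcal{H})$ is the algebra of bounded linear operators on $\mathcal{H}$; $R(T)$ and $N(T)$ are the range and null space of $T$; $P_{\overline{R(A)}}$ is the orthogonal projection of $\mathcal{H}$ onto $\overline{R(A)}$. $A$ positive means $\langle Ax,x\rangle\ge 0$ for all $x$. Put $\langle x,y\rangle_A=\langle Ax,y\rangle$ and $\|x\|_A=\sqrt{\langle x,x\rangle_A}$. $\mathcal{D}=\{z\in\mathbb{C}:|z|\le 1\}$. $\mathcal{B}_{A^{1/2}}(\mathcal{H})=\{T\in\mathcal{B}(\mathcal{H}):\exists c>0,\ \|Tx\|_A\le c\|x\|_A\ \forall x\in\mathcal{H}\}$. The $A$-$q$-numerical range is $W_{q,A}(T)=\{\langle Tx,y\rangle_A: x,y\in\mathcal{H},\ \|x\|_A=\|y\|_A=1,\ \langle x,y\rangle_A=q\}$.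 For $T\in\mathcal{B}_{A^{1/2}}(\mathcal{H})$: the $A$-point spectrum is $\sigma_{A_p}(T)=\{\lambda\in\mathbb{C}:\exists\,x\in\overline{R(A)},\ x\ne 0,\ P_{\overline{R(A)}}Tx=\lambda x\}$; the $A$-approximate point spectrum is $\sigma_{A_{app}}(T)=\{\lambda\in\mathbb{C}:\exists\,\{x_n\}\subseteq\overline{R(A)},\ \|x_n\|_A=1,\ \|(T-\lambda I)x_n\|_A\to 0\}$; the $A$-spectrum is $\sigma_A(T)=\{\lambda\in\mathbb{C}: T-\lambda I \text{ is not } A\text{-invertible in }\mathcal{B}_{A^{1/2}}(\mathcal{H})\}$, where $T$ is $A$-invertible in $\mathcal{B}_{A^{1/2}}(\mathcal{H})$ if there is $S\in\mathcal{B}_{A^{1/2}}(\mathcal{H})$ with $ATS=AST=A$. *)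

(* Defs.v *)
From HB Require Import structures.
From mathcomp Require Import all_boot all_order all_algebra.
From mathcomp Require Import complex.
From mathcomp Require Import all_classical all_reals all_analysis.

Set Implicit Arguments.
Unset Strict Implicit.
Unset Printing Implicit Defensive.

Import Order.TTheory GRing.Theory Num.Theory.
Import numFieldNormedType.Exports.

Local Open Scope classical_set_scope.
Local Open Scope complex_scope.
Local Open Scope ring_scope.

(** A complex Hilbert space is a complete normed module over [R[i]] whose norm
    is induced by an inner product [dot : {dot H for Num.conj}]; such forms are
    linear in the first variable and conjugate-linear in the second.
    The order of [R[i]] is partial: [z <= w] means that [w - z] is a nonnegative
    real number. The usual topology of the complex plane is found on [R[i]^o],
    which is convertible to [R[i]]. *)

Definition norm_from_dot (R : realType) (H : normedModType R[i])
    (dot : {dot H for Num.conj}) : Prop :=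
  forall x : H, `|x| ^+ 2 = dot x x.

Definition separable_space (T : topologicalType) : Prop :=
  exists2 D : set T, countable D & dense D.

(** For a linear subspace [V]: the dimension of [V], finite or infinite,
    is at least [n]. *)
Definition dim_ge (R : realType) (H : lmodType R[i]) (n : nat) (V : set H) :
    Prop :=
  exists2 v : 'I_n -> H, (forall i, V (v i)) &
    forall c : 'I_n -> R[i], \sum_i c i *: v i = 0 -> forall i, c i = 0.

Definition infinite_dimensional (R : realType) (H : lmodType R[i]) : Prop :=
  forall n : nat, dim_ge n [set: H].

Definition bounded_op (R : realType) (H : normedModType R[i])
    (T : {linear H -> H}) : Prop :=
  exists2 c : R[i], 0 < c & forall x : H, `|T x| <= c * `|x|.

Definition positive_op (R : realType) (H : normedModType R[i])
    (dot : {dot H for Num.conj}) (A : {linear H -> H}) : Prop :=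
  forall x : H, 0 <= dot (A x) x.

(** The projection theorem makes the defining set a singleton when [M] is a
    closed subspace of a Hilbert space, so the default value [0] of [xget] is
    not used for such [M]. *)
Definition orth_proj (R : realType) (H : normedModType R[i])
    (dot : {dot H for Num.conj}) (M : set H) (x : H) : H :=
  xget 0 [set m | M m /\ forall u : H, M u -> dot (x - m) u = 0].

Definition dotA (R : realType) (H : normedModType R[i])
    (dot : {dot H for Num.conj}) (A : {linear H -> H}) (x y : H) : R[i] :=
  dot (A x) y.

Definition normA (R : realType) (H : normedModType R[i])
    (dot : {dot H for Num.conj}) (A : {linear H -> H}) (x : H) : R[i] :=
  sqrtC (dotA dot A x x).

(** Membership in $\mathcal{B}_{A^{1/2}}(\mathcal{H})$. *)
Definition A_bounded_op (R : realType) (H : normedModType R[i])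
    (dot : {dot H for Num.conj}) (A T : {linear H -> H}) : Prop :=
  bounded_op T /\
  exists2 c : R[i], 0 < c & forall x : H, normA dot A (T x) <= c * normA dot A x.

Definition A_q_numerical_range (R : realType) (H : normedModType R[i])
    (dot : {dot H for Num.conj}) (A : {linear H -> H}) (q : R[i])
    (T : {linear H -> H}) : set R[i]^o :=
  [set z | exists x y : H,
    [/\ normA dot A x = 1, normA dot A y = 1, dotA dot A x y = q
      & z = dotA dot A (T x) y]].

Definition A_point_spectrum (R : realType) (H : normedModType R[i])
    (dot : {dot H for Num.conj}) (A T : {linear H -> H}) : set R[i] :=
  [set l | exists x : H,
    [/\ closure (range A) x, x != 0
      & orth_proj dot (closure (range A)) (T x) = l *: x]].

Definition A_approx_point_spectrum (R : realType) (H : normedModType R[i])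
    (dot : {dot H for Num.conj}) (A T : {linear H -> H}) : set R[i] :=
  [set l | exists x : nat -> H,
    [/\ forall n, closure (range A) (x n), forall n, normA dot A (x n) = 1
      & normA dot A (T (x n) - l *: x n) @[n --> \oo] --> (0 : R[i]^o)]].

Definition A_invertible (R : realType) (H : normedModType R[i])
    (dot : {dot H for Num.conj}) (A T : {linear H -> H}) : Prop :=
  exists S : {linear H -> H},
    [/\ A_bounded_op dot A S, forall x, A (T (S x)) = A x
      & forall x, A (S (T x)) = A x].

Definition A_spectrum (R : realType) (H : normedModType R[i])
    (dot : {dot H for Num.conj}) (A T : {linear H -> H}) : set R[i] :=
  [set l | ~ A_invertible dot A (T \- l \*: idfun)].

(* Main.v *)
Require Import Defs.
From HB Require Import structures.
From mathcomp Require Import all_boot all_order all_algebra.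
From mathcomp Require Import complex.
From mathcomp Require Import all_classical all_reals all_analysis.
From mathcomp Require Import ring lra.

Set Implicit Arguments.
Unset Strict Implicit.
Unset Printing Implicit Defensive.

Import Order.TTheory GRing.Theory Num.Theory.
Import numFieldNormedType.Exports.

Local Open Scope classical_set_scope.
Local Open Scope complex_scope.
Local Open Scope ring_scope.

(** Write <x, y>_A for <A x, y>. As A is positive on a complex space, this is a
    semi-inner product: it is hermitian by polarization and satisfies the
    Cauchy-Schwarz inequality, and its null space is the kernel of A.

    All three inclusions rest on one observation ([exists_inner_productA]): when
    R(A) has dimension at least 2 and |q| <= 1, every x with ||x||_A = 1 has a
    partner y with ||y||_A = 1 and <x, y>_A = q, namely
    y = q^* x + sqrt(1 - |q|^2) z for an A-unit vector z that is A-orthogonal to x.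
    If x is an approximate eigenvector for l, then <T x, y>_A differs from
    l <x, y>_A = q l by at most ||T x - l x||_A, so q l is a limit of values; this
    is the case of the approximate point spectrum. For the point spectrum, the
    equation P T x = l x means A T x = l A x, since A P = A by the projection
    theorem ([exists_orth_proj]), and a nonzero x in the closure of R(A) can be
    normalized, as that closure meets N(A) only in 0; here q l itself is a value.

    For the A-spectrum, put K = T - l. If K is not bounded below for the
    A-seminorm, then l has A-unit approximate eigenvectors, as before. Otherwise
    the closedness of R(A) enters. The uniform boundedness principle
    ([uniform_boundedness]) gives ||z|| <= c ||A z|| on R(A), so the norm and the
    A-seminorm are equivalent on R(A) and A K has a closed range. Were this range
    all of R(A), solving A K x = A u with x in R(A) would define an A-inverse of
    K. Hence it is a proper closed subspace of R(A), and some A-unit vector y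
    satisfies <K x, y>_A = 0 for all x; that is, <T x, y>_A = l <x, y>_A. With x
    the partner of y for which <x, y>_A = q, the value q l is attained. *)

(** * The semi-inner product of a positive operator *)

Section PositiveForm.
Variables (R : realType) (H : normedModType R[i]) (dot : {dot H for Num.conj}).
Variable A : {linear H -> H}.
Hypothesis A_positive : positive_op dot A.
Local Notation C := R[i].
Local Notation "<[ x , y ]>" := (dotA dot A x y).
Local Notation nA := (normA dot A).

Lemma dotADl x y z : <[x + y, z]> = <[x, z]> + <[y, z]>.
Proof. by rewrite /dotA linearD linearDl. Qed.
Lemma dotADr x y z : <[x, y + z]> = <[x, y]> + <[x, z]>.
Proof. by rewrite /dotA linearDr. Qed.
Lemma dotAZl a x z : <[a *: x, z]> = a * <[x, z]>.
Proof. by rewrite /dotA linearZ linearZl_LR. Qed.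
Lemma dotAZr a x z : <[x, a *: z]> = a^* * <[x, z]>.
Proof. by rewrite /dotA linearZr_LR. Qed.
Lemma dotANl x z : <[- x, z]> = - <[x, z]>.
Proof. by rewrite /dotA linearN linearNl. Qed.
Lemma dotANr x z : <[x, - z]> = - <[x, z]>.
Proof. by rewrite /dotA linearNr. Qed.
Lemma dotABl x y z : <[x - y, z]> = <[x, z]> - <[y, z]>.
Proof. by rewrite dotADl dotANl. Qed.
Lemma dotABr x y z : <[x, y - z]> = <[x, y]> - <[x, z]>.
Proof. by rewrite dotADr dotANr. Qed.

Lemma dotA_ge0 x : 0 <= <[x, x]>.
Proof. exact: A_positive. Qed.

(** Positivity makes every <z, z>_A real; comparing the real numbers
    <x + y, x + y>_A and <x + i y, x + i y>_A with their conjugates yields the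
    symmetry. This is where the complex scalars matter. *)
Lemma dotAC x y : <[x, y]> = (<[y, x]>)^*.
Proof.
have re z : (<[z, z]>)^* = <[z, z]> by apply/CrealP/ger0_real/dotA_ge0.
have := re (x + 'i *: y); have := re (x + y).
rewrite !(dotADl, dotADr, dotAZl, dotAZr) !(rmorphD, rmorphM) /= !re !conjCK conjCi => h1 h2.
move: h1 h2; set c' := (<[x, y]>)^*; set d' := (<[y, x]>)^*.
set c := <[x, y]>; set d := <[y, x]>.
move: (<[x, x]>) (<[y, y]>) => a b; move: c d c' d' => c d c' d' h1 h2.
have e1 : c' + d' = c + d.
  apply/eqP; rewrite -subr_eq0; apply/eqP.
  transitivity ((a + c' + (d' + b)) - (a + c + (d + b))); first by ring.
  by rewrite h1 subrr.
have e2 : d' - c' = c - d.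
  apply: (mulfI (neq0Ci C)); apply/eqP; rewrite -subr_eq0; apply/eqP.
  transitivity (('i * (- 'i * b) + a + - 'i * c + 'i * d) -
    (a + 'i * c' + (- 'i * d' + - 'i * ('i * b)))); first by ring.
  by rewrite h2; ring.
apply: (mulfI (_ : 2 != 0 :> C)); first by rewrite pnatr_eq0.
transitivity (c + d + (c - d)); first by ring.
by rewrite -e1 -e2; ring.
Qed.

Lemma normA_ge0 x : 0 <= nA x.
Proof. by rewrite sqrtC_ge0 dotA_ge0. Qed.
Hint Resolve normA_ge0 : core.

Lemma normA_sq x : nA x ^+ 2 = <[x, x]>.
Proof. exact: sqrtCK. Qed.

Lemma normAZ a x : nA (a *: x) = `|a| * nA x.
Proof.
apply: (@pexpIrn _ 2) => //; rewrite ?nnegrE ?mulr_ge0//.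
by rewrite exprMn !normA_sq dotAZl dotAZr mulrA normCK.
Qed.

Lemma normAN x : nA (- x) = nA x.
Proof. by rewrite -scaleN1r normAZ normrN1 mul1r. Qed.

(** Expand the square of the seminorm of <y, y>_A x - <x, y>_A y. The degenerate
    case <y, y>_A = 0 forces <x, y>_A = 0, since otherwise subtracting a large
    multiple of y from x would make a square negative. *)
Theorem dotA_CS x y : `|<[x, y]>| <= nA x * nA y.
Proof.
rewrite -(@ler_pXn2r _ 2) ?nnegrE ?mulr_ge0// exprMn !normA_sq.
have [y0|y0] := eqVneq <[y, y]> 0.
  have [/eqP -> |p0] := boolP (<[x, y]> == 0).
    by rewrite normr0 expr0n /= mulr_ge0 ?dotA_ge0.
  (* with this multiple, the square of x - t y is - <x, x>_A - 2 *)
  pose t := (<[x, x]> + 1) / <[y, x]>.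
  have p1 : <[y, x]> != 0 by rewrite dotAC conjC_eq0.
  have t1 : t * <[y, x]> = <[x, x]> + 1 by rewrite mulfVK.
  have t2 : t^* * <[x, y]> = <[x, x]> + 1.
    rewrite [<[x, y]>]dotAC -rmorphM t1 rmorphD rmorph1 /=.
    by rewrite (CrealP (ger0_real (dotA_ge0 x))).
  have := dotA_ge0 (x - t *: y).
  rewrite !(dotABl, dotABr, dotAZl, dotAZr) y0 t1 t2 !mulr0 subr0.
  rewrite (_ : _ - _ = - (<[x, x]> + 2)); last by ring.
  by rewrite oppr_ge0 lt_geF// ltr_wpDl ?dotA_ge0.
have y1 : 0 < <[y, y]> by rewrite lt0r y0 dotA_ge0.
have := dotA_ge0 (<[y,y]> *: x - <[x,y]> *: y).
rewrite !(dotABl, dotABr, dotAZl, dotAZr) (CrealP (ger0_real (dotA_ge0 y))).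
rewrite [X in _ - X](_ : _ = 0); last by rewrite (mulrC _ <[y, y]>) -dotAC; ring.
rewrite subr0 (_ : _ - _ = <[y, y]> * (<[x, x]> * <[y, y]> - `|<[x, y]>| ^+ 2)).
  by rewrite pmulr_rge0// subr_ge0.
by rewrite normCK -dotAC; ring.
Qed.

Lemma normAD x y : nA (x + y) <= nA x + nA y.
Proof.
rewrite -(@ler_pXn2r _ 2) ?nnegrE ?addr_ge0// sqrrD !normA_sq.
rewrite !(dotADl, dotADr) (dotAC y x) addrA -[_ + _ + _^*]addrA lerD2r lerD2l.
have cs := dotA_CS x y; have: <[x, y]> + (<[x, y]>)^* \is Num.real.
  by apply/CrealP; rewrite rmorphD /= conjCK addrC.
move=> /real_ler_norm/le_trans; apply; apply: (le_trans (ler_normD _ _)).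
by rewrite norm_conjC mulr2n lerD.
Qed.

(** The Cauchy-Schwarz inequality for x and A x bounds ||A x||^2 by
    ||x||_A ||A x||_A. *)
Lemma normA_eq0 x : nA x = 0 -> A x = 0.
Proof.
move=> x0; apply/eqP; rewrite -(dnorm_eq0 dot) -normr_le0.
by apply: le_trans (dotA_CS x (A x)) _; rewrite x0 mul0r.
Qed.

Lemma normA_ker x : A x = 0 -> nA x = 0.
Proof. by move=> x0; rewrite /normA /dotA x0 linear0l sqrtC0. Qed.

Lemma A_selfadjoint x y : dot (A x) y = dot x (A y).
Proof. by rewrite -/(dotA dot A x y) dotAC /dotA [RHS]hermC /= expr0 mul1r. Qed.

(** If no w had a component off x for the seminorm, then A w = <w, x>_A A x for
    all w and the range of A would be a line; otherwise Gram-Schmidt applies. *)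
Lemma exists_orthonormalA x : dim_ge 2 (range A) -> nA x = 1 ->
  exists2 z, nA z = 1 & <[x, z]> = 0.
Proof.
move=> [v vA v_free] x1.
have x2 : <[x, x]> = 1 by rewrite -normA_sq x1 expr1n.
have [[w w0]|w0] := pselect (exists w, nA (w - <[w, x]> *: x) != 0).
  set u := w - _ in w0; exists ((nA u)^-1 *: u).
    by rewrite normAZ gtr0_norm ?invr_gt0 ?lt0r ?w0 ?normA_ge0 ?mulVf.
  by rewrite dotAZr /u dotABr dotAZr x2 mulr1 -dotAC subrr mulr0.
have {}w0 w : A w = <[w, x]> *: A x.
  apply/eqP; rewrite -linearZ -subr_eq0 -linearB; apply/eqP/normA_eq0/eqP.
  by apply/negP => /negP h; apply: w0; exists w.
have [w1 _ e1] := vA 0; have [w2 _ e2] := vA 1.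
have {}v_free a b : a *: v 0 + b *: v 1 = 0 -> a = 0 /\ b = 0.
  move=> ab0; have := v_free (fun i => if i == 0 then a else b).
  rewrite big_ord_recl big_ord1 (_ : lift _ _ = 1); last exact/val_inj.
  by move=> /(_ ab0) h; split; [exact: (h 0) | exact: (h 1)].
have [] := v_free <[w2, x]> (- <[w1, x]>).
  rewrite -e1 -e2 (w0 w1) (w0 w2) !scalerA -scalerDl.
  by rewrite mulrC mulNr subrr scale0r.
move=> w2x _; have [] := v_free 0 1.
  by rewrite scale0r scale1r add0r -e2 w0 w2x scale0r.
by move=> _ /eqP; rewrite oner_eq0.
Qed.

(** Take y = q^* x + sqrt(1 - |q|^2) z, with z an A-unit vector A-orthogonal to x:
    the first coefficient produces the value q, the second restores the seminorm
    to 1, which |q| <= 1 makes possible. *)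
Lemma exists_inner_productA q x : dim_ge 2 (range A) -> `|q| <= 1 -> nA x = 1 ->
  exists2 y, nA y = 1 & <[x, y]> = q.
Proof.
move=> rk q1 x1; have [z z1 xz] := exists_orthonormalA rk x1.
have x2 : <[x, x]> = 1 by rewrite -normA_sq x1 expr1n.
have z2 : <[z, z]> = 1 by rewrite -normA_sq z1 expr1n.
have s0 : 0 <= 1 - `|q| ^+ 2 by rewrite subr_ge0 exprn_ile1.
have := sqrtCK (1 - `|q| ^+ 2); have := s0; rewrite -sqrtC_ge0.
move: (sqrtC _) => s /ger0_real/CrealP s_real s_sq.
exists (q^* *: x + s *: z).
  rewrite /normA !(dotADl, dotADr, dotAZl, dotAZr) (dotAC z x) xz x2 z2.
  rewrite rmorph0 conjCK s_real !mulr0 addr0 add0r !mulr1.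
  by rewrite -expr2 s_sq mulrC -normCK addrC subrK sqrtC1.
by rewrite dotADr !dotAZr xz x2 conjCK mulr0 addr0 mulr1.
Qed.
End PositiveForm.

(** * Real-valued norms and convergence *)

Lemma natSinv_small (R : realType) (e : R) : 0 < e ->
  exists N, forall n, (N <= n)%N -> n.+1%:R^-1 < e.
Proof.
move=> e0; have [N _ NE] := near_infty_natSinv_lt (PosNum e0).
by exists N => n /NE.
Qed.

Section RealNorm.
Variables (R : realType) (H : normedModType R[i]).
Implicit Types x y : H.

(** The norm with values in R rather than in R[i], whose order is only partial:
    infima, case distinctions and linear arithmetic then become available. *)
Definition rnorm x : R := complex.Re `|x|.

Lemma rnormE x : (rnorm x)%:C = `|x|.
Proof. exact: RRe_real. Qed.

Lemma rnorm_ge0 x : 0 <= rnorm x.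
Proof. by rewrite -ler0c rnormE. Qed.

Lemma rnorm_le x y : (rnorm x <= rnorm y) = (`|x| <= `|y|).
Proof. by rewrite -lecR !rnormE. Qed.

Lemma rnormD x y : rnorm (x + y) <= rnorm x + rnorm y.
Proof. by rewrite -lecR rmorphD /= !rnormE ler_normD. Qed.

Lemma rnormN x : rnorm (- x) = rnorm x.
Proof. by rewrite /rnorm normrN. Qed.

Lemma rnorm_dist x y : rnorm (x - y) = rnorm (y - x).
Proof. by rewrite /rnorm distrC. Qed.

Lemma rnorm_tri y x z : rnorm (x - z) <= rnorm (x - y) + rnorm (y - z).
Proof. by apply: le_trans (rnormD _ _); rewrite addrA subrK. Qed.

Lemma rnorm0 : rnorm (0 : H) = 0.
Proof. by rewrite /rnorm normr0. Qed.

Lemma rnorm0_eq0 x : rnorm x = 0 -> x = 0.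
Proof. by move=> x0; apply/eqP; rewrite -normr_eq0 -rnormE x0. Qed.

Lemma rnormZ (r : R) x : rnorm (r%:C *: x) = `|r| * rnorm x.
Proof.
apply: complexI; rewrite rmorphM /= !rnormE normrZ normc_def /=.
by rewrite expr0n /= addr0 sqrtr_sqr.
Qed.

Lemma pos_complexP (e : R[i]) : 0 < e -> exists2 r : R, 0 < r & e = r%:C.
Proof.
by move=> e0; exists (complex.Re e); [rewrite -ltcR|]; rewrite RRe_real ?gtr0_real.
Qed.

Lemma cvg_rnormP (u : nat -> H) l : u n @[n --> \oo] --> l <->
  forall e : R, 0 < e -> exists N, forall n, (N <= n)%N -> rnorm (l - u n) < e.
Proof.
split=> [/cvgrPdist_lt ul e e0|ul].
  have [|N _ Nul] := ul e%:C; first by rewrite ltcR.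
  by exists N => n /Nul /=; rewrite -ltcR rnormE.
apply/cvgrPdist_lt => _ /pos_complexP[e e0 ->].
have [N Nul] := ul e e0; exists N => // n /Nul.
by rewrite -ltcR rnormE.
Qed.

Lemma closure_rnormP (M : set H) x : closure M x <->
  forall e : R, 0 < e -> exists2 y, M y & rnorm (x - y) < e.
Proof.
split=> [Mx e e0|Mx B /nbhs_ballP[_ /pos_complexP[e e0 ->]] eB].
  have [|y [My xy]] := Mx (ball x e%:C).
    by apply/nbhs_ballP; exists e%:C => //=; rewrite ltcR.
  by exists y => //; move: xy; rewrite -ball_normE /= -rnormE ltcR.
have [y My xy] := Mx e e0; exists y; split=> //; apply: eB.
by rewrite -ball_normE /= -rnormE ltcR.
Qed.

End RealNorm.

Definition closed_subspace (R : realType) (H : normedModType R[i]) (M : set H) :=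
  [/\ closed M, M 0 & forall (a : R[i]) x y, M x -> M y -> M (a *: x + y)].

Section Complete.
Variables (R : realType) (H : completeNormedModType R[i]).

Lemma rnorm_cauchy_cvg (u : nat -> H) :
  (forall e : R, 0 < e -> exists N, forall m n, (N <= m)%N -> (N <= n)%N ->
     rnorm (u m - u n) < e) ->
  exists l : H, u n @[n --> \oo] --> l.
Proof.
move=> uC; have cu : cauchy (u @ \oo).
  apply/cauchy_exP => _ /pos_complexP[e e0 ->].
  have [N uN] := uC e e0; exists (u N); exists N => // n /= Nn.
  by rewrite -ball_normE /= -rnormE ltcR uN.
by exists (lim (u @ \oo)); exact: cauchy_cvg cu.
Qed.

End Complete.

Lemma closed_seq_cvg (R : realType) (H : normedModType R[i]) (M : set H) (u : nat -> H) l :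
  closed M -> (forall n, M (u n)) -> u n @[n --> \oo] --> l -> M l.
Proof. move=> Mc Mu; apply: (closed_cvg _ Mc); exact: nearW. Qed.

(** * The projection theorem *)

Section InnerProduct.
Variables (R : realType) (H : completeNormedModType R[i]) (dot : {dot H for Num.conj}).
Hypothesis H_hilbert : norm_from_dot dot.

Lemma rnorm_parallelogram (x y : H) :
  rnorm (x + y) ^+ 2 + rnorm (x - y) ^+ 2 = 2 * (rnorm x ^+ 2 + rnorm y ^+ 2).
Proof.
have E : `|x + y| ^+ 2 + `|x - y| ^+ 2 = 2 * (`|x| ^+ 2 + `|y| ^+ 2).
  by rewrite !H_hilbert !(linearDl, linearNl) /= !(linearDr, linearNr) /=; ring.
apply: complexI; rewrite mulr_natl mulr_natl in E *.
by rewrite !rmorphMn !rmorphD !rmorphXn /= !rnormE.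
Qed.

Lemma id_positive : positive_op dot idfun.
Proof. by move=> x /=; rewrite -H_hilbert exprn_ge0. Qed.

(** The inner product is the form of the identity operator. *)
Lemma dot_CS (x y : H) : `|dot x y| <= `|x| * `|y|.
Proof.
have nE z : normA dot idfun z = `|z| by rewrite /normA /dotA -H_hilbert sqrCK.
by have := dotA_CS id_positive x y; rewrite !nE.
Qed.

Variable M : set H.
Hypothesis M_closed : closed_subspace M.

(** A minimizing sequence for the distance to M is Cauchy by the parallelogram
    law, because midpoints of elements of M are in M. *)
Lemma exists_nearest x : exists2 m, M m & forall u, M u -> rnorm (x - m) <= rnorm (x - u).
Proof.
have [Mc M0 MD] := M_closed.
pose E := [set rnorm (x - m) | m in M]; pose d := inf E.
have Elb : lbound E 0 by move=> _ [m _ <-]; exact: rnorm_ge0.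
have Einf : has_inf E by split; [exists (rnorm (x - 0)), 0 | exists 0].
have dle u : M u -> d <= rnorm (x - u).
  by move=> Mu; apply: ge_inf; [exists 0 | exists u].
have d0 : 0 <= d by apply: lb_le_inf => //; case: Einf.
have inv0 n : 0 < n.+1%:R^-1 :> R by rewrite invr_gt0.
have inv1 n : n.+1%:R^-1 <= 1 :> R by rewrite invf_le1// ler1n.
have /choice[u uP] : forall n, exists m, M m /\ rnorm (x - m) < d + n.+1%:R^-1.
  by move=> n; have [_ [m Mm <-] lt] := inf_adherent (inv0 n) Einf; exists m.
have uM n : M (u n) by case: (uP n).
have mid a b : M a -> M b -> 2 * d <= rnorm ((x - a) + (x - b)).
  move=> Ma Mb; pose h : R := 2^-1.
  have hh : h%:C + h%:C = 1 by rewrite -rmorphD (_ : h + h = 1) // /h; lra.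
  have e : x - (h%:C *: a + (h%:C *: b + 0)) = h%:C *: ((x - a) + (x - b)).
    by rewrite addr0 scalerDr !scalerBr addrACA -scalerDl hh scale1r opprD.
  have := dle _ (MD h%:C _ _ Ma (MD h%:C _ _ Mb M0)).
  by rewrite e rnormZ ger0_norm ?invr_ge0// ler_pdivlMl.
have [l ul] : exists l : H, u n @[n --> \oo] --> l.
  apply: rnorm_cauchy_cvg => e e0.
  (* by the parallelogram law, the square of the distance between two terms with
     errors s, t <= 1 is at most 2 ((d + s)^2 + (d + t)^2) - (2 d)^2, hence at
     most (4 d + 2) (s + t) *)
  have den : 0 < 8 * d + 4 by lra.
  have [|N Ns] := natSinv_small (e := e ^+ 2 / (8 * d + 4)); first by rewrite divr_gt0 ?exprn_gt0.
  exists N => m n Nm Nn.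
  have := rnorm_parallelogram (x - u m) (x - u n).
  have := mid _ _ (uM m) (uM n).
  rewrite [X in _ + rnorm X ^+ 2](_ : _ = u n - u m); last first.
    by rewrite opprB addrC addrA subrK.
  move: (Ns _ Nm) (Ns _ Nn) (proj2 (uP m)) (proj2 (uP n)) (inv0 m) (inv0 n) (inv1 m) (inv1 n).
  rewrite !ltr_pdivlMr//.
  move: (rnorm_ge0 (x - u m)) (rnorm_ge0 (x - u n)) (rnorm_ge0 (u n - u m)).
  rewrite [rnorm (u m - _)]rnorm_dist.
  move: (rnorm (x - u m)) (rnorm (x - u n)) (rnorm (u n - u m)) (rnorm ((x - u m) + (x - u n))).
  move: (m.+1%:R^-1) (n.+1%:R^-1).
  move=> s t a b c f a0 b0 c0 se te ad bd s0 t0 s1 t1 df par.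
  rewrite -(@ltr_pXn2r _ 2) ?nnegrE ?(ltW e0)//.
  have sq r v : 0 <= r -> r < d + v -> 0 < v -> v <= 1 ->
      r ^+ 2 <= d ^+ 2 + (2 * d + 1) * v.
    move=> r0 rd v0 v1; apply: (@le_trans _ _ ((d + v) ^+ 2)).
      by rewrite ler_pXn2r ?nnegrE ?addr_ge0 ?(ltW v0) ?(ltW rd).
    by rewrite sqrrD -subr_ge0; nra.
  have a2 := sq a s a0 ad s0 s1; have b2 := sq b t b0 bd t0 t1.
  have f2 : (2 * d) ^+ 2 <= f ^+ 2.
    by rewrite ler_pXn2r ?nnegrE ?mulr_ge0// (le_trans _ df) ?mulr_ge0.
  lra.
exists l => [|w Mw]; first exact: closed_seq_cvg uM ul.
suff lim_le (e : R) : 0 < e -> rnorm (x - l) <= d + e.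
  by apply: le_trans (dle _ Mw); apply/ler_addgt0Pr.
move=> e0.
have e2 : 0 < e / 2 by rewrite divr_gt0.
have [N1 h1] := (cvg_rnormP _ _).1 ul _ e2; have [N2 h2] := natSinv_small e2.
pose n := maxn N1 N2.
have := h1 n (leq_maxl _ _); have := h2 n (leq_maxr _ _).
have := rnorm_tri (u n) x l; rewrite (rnorm_dist (u n)).
have := (uP n).2.
by move: (n.+1%:R^-1) => s; lra.
Qed.

(** If m is nearest to x in M, then moving m along u by the coefficient of x - m
    on u cannot shorten x - m, which forces this coefficient to vanish. *)
Theorem exists_orth_proj x : exists2 m, M m & forall u, M u -> dot (x - m) u = 0.
Proof.
have [m Mm mle] := exists_nearest x; exists m => // u Mu.
have [Mc M0 MD] := M_closed.
have [->|u0] := eqVneq u 0; first by rewrite linear0r.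
have uu : 0 < dot u u by rewrite dnorm_gt0.
set v := x - m; set p := dot v u; pose t := p / dot u u.
have : `|v| ^+ 2 <= `|v - t *: u| ^+ 2.
  rewrite ler_pXn2r ?nnegrE// -rnorm_le (_ : v - _ = x - (t *: u + m)).
    by apply: mle; exact: MD.
  by rewrite opprD addrA addrAC.
rewrite /p; move: v @p @t => v p t.
have tu : t * dot u u = p by rewrite /t mulfVK// gt_eqF.
have uv : dot u v = p^* by rewrite hermC /= expr0 mul1r.
clearbody t; rewrite !H_hilbert linearBl /= !linearBr /= !linearZl_LR /= !linearZr_LR /=.
rewrite -/p uv tu -[_ *: _]/(t^* * p) -subr_ge0 => h.
rewrite (_ : _ - _ = - (t * p^*)) in h; last by ring.
have := mulr_ge0 h (ltW uu); rewrite mulNr mulrAC tu -normCK oppr_ge0 => p2.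
by apply/eqP; rewrite -normr_eq0 -sqrf_eq0 eq_le p2 exprn_ge0.
Qed.
End InnerProduct.

(** * Eigenvalues and the numerical range *)

Section NumericalRange.
Variables (R : realType) (H : completeNormedModType R[i]) (dot : {dot H for Num.conj}).
Hypothesis H_hilbert : norm_from_dot dot.
Variable A : {linear H -> H}.
Hypothesis A_positive : positive_op dot A.
Hypothesis A_rank : dim_ge 2 (range A).
Local Notation "<[ x , y ]>" := (dotA dot A x y).
Local Notation nA := (normA dot A).

Lemma closure_range_subspace : closed_subspace (closure (range A)).
Proof.
split; [exact: closed_closure | by apply: subset_closure; exists 0 => //; rewrite linear0 |].
move=> a x y /closure_rnormP Mx /closure_rnormP My; apply/closure_rnormP => e e0.
pose r := rnorm (a : R[i]^o).
have r0 : 0 < r + 1 by rewrite ltr_wpDl// rnorm_ge0.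
have [|_ [x' _ <-] xx'] := Mx (e / 2 / (r + 1)); first by rewrite !divr_gt0.
have [|_ [y' _ <-] yy'] := My (e / 2); first by rewrite divr_gt0.
exists (A (a *: x' + y')); first by exists (a *: x' + y').
rewrite linearP opprD addrACA -scalerBr.
apply: le_lt_trans (rnormD _ _) _.
have -> : rnorm (a *: (x - A x')) = r * rnorm (x - A x').
  by apply: complexI; rewrite rmorphM /= /r !rnormE normrZ.
move: xx'; rewrite ltr_pdivlMr// => xx'.
have := rnorm_ge0 (x - A x'); move: (rnorm _) (rnorm (y - _)) r xx' yy' {r0} => s t r *; nra.
Qed.

(** The orthogonal complement of the closure of R(A) is N(A), as A is
    self-adjoint. *)
Lemma closure_range_orth x : (forall y, closure (range A) y -> dot x y = 0) <-> A x = 0.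
Proof.
split=> [xM|Ax0 y /closure_rnormP My].
  apply/eqP; rewrite -(dnorm_eq0 dot) (A_selfadjoint A_positive) xM//.
  by apply: subset_closure; exists (A x).
apply/eqP; rewrite -normr_le0 -(rnormE (dot x y : R[i]^o)) lecR.
apply/ler_addgt0Pr => e e0; rewrite add0r.
have [|_ [z _ <-] yz] := My (e / (rnorm x + 1)).
  by rewrite divr_gt0// ltr_wpDl ?rnorm_ge0.
have -> : dot x y = dot x (y - A z).
  by rewrite linearBr /= -(A_selfadjoint A_positive) Ax0 linear0l subr0.
move: yz; rewrite ltr_pdivlMr ?ltr_wpDl ?rnorm_ge0// mulrDr mulr1.
have : rnorm (dot x (y - A z) : R[i]^o) <= rnorm x * rnorm (y - A z).
  by rewrite -lecR rmorphM /= !rnormE dot_CS.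
have := rnorm_ge0 (y - A z); rewrite mulrC; lra.
Qed.

Lemma closure_range_ker x : closure (range A) x -> A x = 0 -> x = 0.
Proof.
by move=> Mx /closure_range_orth/(_ _ Mx)/eqP; rewrite dnorm_eq0 => /eqP.
Qed.

Lemma normA_gt0 x : closure (range A) x -> x != 0 -> 0 < nA x.
Proof.
move=> Mx; rewrite lt0r normA_ge0// andbT; apply: contraNN => /eqP.
by move=> /(normA_eq0 A_positive)/(closure_range_ker Mx) ->.
Qed.

(** x - P x is orthogonal to the closure of R(A), hence in N(A). *)
Lemma orth_proj_closure_range x :
  A (orth_proj dot (closure (range A)) x) = A x.
Proof.
rewrite /orth_proj; case: xgetP => [m _ [_ mP]|noproj].
  by apply/esym/eqP; rewrite -subr_eq0 -linearB; apply/eqP/closure_range_orth.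
have [m Mm mP] := exists_orth_proj H_hilbert closure_range_subspace x.
by case: (noproj m).
Qed.

Lemma normalizeA x : 0 < nA x -> nA ((nA x)^-1 *: x) = 1.
Proof. by move=> x0; rewrite normAZ// gtr0_norm ?invr_gt0// mulVf// gt_eqF. Qed.

Lemma point_spectrum_numerical_range T q l : `|q| <= 1 ->
  A_point_spectrum dot A T l -> A_q_numerical_range dot A q T (q * l).
Proof.
move=> q1 [x [Mx x0 Tx]]; have nx := normA_gt0 Mx x0.
have {}Tx : A (T x) = l *: A x by rewrite -orth_proj_closure_range Tx linearZ.
have [y y1 xy] := exists_inner_productA A_positive A_rank q1 (normalizeA nx).
exists ((nA x)^-1 *: x), y; split=> //; first exact: normalizeA.
rewrite mulrC -xy -dotAZl /dotA; congr (dot _ y).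
by rewrite !linearZ /= Tx !scalerA mulrC.
Qed.

(** For y a partner of x, <T x, y>_A - q l = <T x - l x, y>_A, which the
    Cauchy-Schwarz inequality bounds by ||T x - l x||_A. *)
Lemma approx_eigen_numerical_range (T : {linear H -> H}) q l : `|q| <= 1 ->
  (forall e, 0 < e -> exists2 x, nA x = 1 & nA (T x - l *: x) < e) ->
  closure (A_q_numerical_range dot A q T) (q * l).
Proof.
move=> q1 Tl B /nbhs_ballP[e e0 eB]; have [x x1 Tx] := Tl e e0.
have [y y1 xy] := exists_inner_productA A_positive A_rank q1 x1.
exists <[T x, y]>; split; first by exists x, y.
apply: eB; rewrite -ball_normE /= distrC.
have -> : <[T x, y]> - q * l = <[T x - l *: x, y]>.
  by rewrite dotABl dotAZl xy mulrC.
by apply: le_lt_trans (dotA_CS A_positive _ _) _; rewrite y1 mulr1.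
Qed.

Lemma approx_point_spectrum_numerical_range (T : {linear H -> H}) q l : `|q| <= 1 ->
  A_approx_point_spectrum dot A T l ->
  closure (A_q_numerical_range dot A q T) (q * l).
Proof.
move=> q1 [x [_ x1 xl]].
apply: approx_eigen_numerical_range => // e e0.
have [N _ /(_ N (leqnn N))] := xl _ (nbhsx_ballx (0 : R[i]^o) e e0).
by rewrite /= -ball_normE /= sub0r normrN ger0_norm ?normA_ge0//; exists (x N).
Qed.

End NumericalRange.

(** * Uniform boundedness on a closed subspace *)

Section UniformBoundedness.
Variables (R : realType) (H : completeNormedModType R[i]) (dot : {dot H for Num.conj}).
Hypothesis H_hilbert : norm_from_dot dot.
Local Notation abs z := (rnorm (z : R[i]^o)).

Lemma rnorm_CS (x y : H) : abs (dot x y) <= rnorm x * rnorm y.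
Proof. by rewrite -lecR rmorphM /= !rnormE dot_CS. Qed.

Lemma inv3_le n : 3^-1 ^+ n <= n.+1%:R^-1 :> R.
Proof.
rewrite exprVn lef_pV2 ?posrE ?exprn_gt0// -natrX ler_nat.
exact: ltn_expl.
Qed.

(** Of the two vectors u + a w and u - a w, one has an inner product with w at
    least as large as that of a w, since the two inner products differ by twice
    the latter. *)
Lemma gliding_hump_step (n : nat) (u w : H) : rnorm w != 0 -> exists2 u',
  (exists a : R[i], u' = a *: w + u) &
  rnorm (u' - u) <= 3^-1 ^+ n /\ 3^-1 ^+ n * rnorm w <= abs (dot u' w).
Proof.
move=> w0; have : 0 < 3^-1 ^+ n :> R by rewrite exprn_gt0// invr_gt0.
move: (3^-1 ^+ n) => c c0.
have [a aw] : exists a : R, rnorm (a%:C *: w) = c.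
  exists (c / rnorm w).
  by rewrite rnormZ ger0_norm ?divr_ge0 ?rnorm_ge0 ?(ltW c0)// mulfVK.
have daw : abs (dot (a%:C *: w) w) = c * rnorm w.
  apply: complexI; rewrite rnormE -aw rmorphM /= !rnormE.
  by rewrite linearZl_LR /= -H_hilbert normrM normrX normr_id normrZ expr2 mulrA.
have tri : 2 * (c * rnorm w) <= abs (dot (a%:C *: w + u) w) + abs (dot ((- a%:C) *: w + u) w).
  rewrite -daw.
  have -> : 2 * abs (dot (a%:C *: w) w) = rnorm (dot (a%:C *: w) w + dot (a%:C *: w) w : R[i]^o).
    have := rnormZ 2 (dot (a%:C *: w) w : R[i]^o).
    rewrite ger0_norm// => <-; congr rnorm.
    by rewrite (rmorph_nat (real_complex R) 2) scaler_nat.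
  have -> : dot (a%:C *: w) w + dot (a%:C *: w) w =
      dot (a%:C *: w + u) w - dot ((- a%:C) *: w + u) w.
    by rewrite !linearDl /= scaleNr linearNl /=; ring.
  by apply: le_trans (rnormD _ _) _; rewrite rnormN.
have [h|h] := leP (c * rnorm w) (abs (dot (a%:C *: w + u) w)).
  exists (a%:C *: w + u); first by exists a%:C.
  by rewrite addrK aw.
exists ((- a%:C) *: w + u); first by exists (- a%:C).
by rewrite addrK scaleNr rnormN aw; split=> //; rewrite -scaleNr; lra.
Qed.

(** The uniform boundedness principle for functionals represented by vectors of a
    closed subspace, by a gliding hump: a series of steps of lengths 3^-n in the
    directions of w_n, with signs chosen by [gliding_hump_step]. The steps after
    the n-th one have total length at most 3^-n / 2, so they cannot undo more
    than half of the inner product with w_n that the n-th step has created; if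
    ||w_n|| > n 3^n, the limit has unbounded inner products with the w_n. *)
Lemma uniform_boundedness (M W : set H) : closed_subspace M -> W `<=` M ->
  (forall u, M u -> exists c : R, forall w, W w -> abs (dot u w) <= c) ->
  exists c : R, forall w, W w -> rnorm w <= c.
Proof.
move=> [Mc M0 MD] WM ptw; apply: contrapT => unb.
have /choice[w wP] : forall n : nat, exists w, W w /\ n%:R * 3 ^+ n < rnorm w.
  move=> n; apply: contrapT => nw; apply: unb; exists (n%:R * 3 ^+ n) => w Ww.
  by rewrite leNgt; apply/negP => lt; apply: nw; exists w.
have w0 n : rnorm (w n) != 0.
  by rewrite gt_eqF// (le_lt_trans _ (wP n).2)// mulr_ge0.
have /choice[f fP] : forall p : nat * H, exists u',
    (exists a : R[i], u' = a *: w p.1 + p.2) /\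
    (rnorm (u' - p.2) <= 3^-1 ^+ p.1 /\
      3^-1 ^+ p.1 * rnorm (w p.1) <= abs (dot u' (w p.1))).
  by move=> p; have [u' ? ?] := gliding_hump_step p.1 p.2 (w0 p.1); exists u'.
pose u n := iteri n (fun i v => f (i, v)) 0.
have uS n : u n.+1 = f (n, u n) by [].
have Mu n : M (u n).
  elim: n => // n IH; rewrite uS; have [[a ->] _] := fP (n, u n).
  by apply: MD => //; apply/WM/(wP n).1.
have ustep n : rnorm (u n.+1 - u n) <= 3^-1 ^+ n by rewrite uS; case: (fP (n, u n)) => _ [].
have uw n : 3^-1 ^+ n * rnorm (w n) <= abs (dot (u n.+1) (w n)).
  by rewrite uS; case: (fP (n, u n)) => _ [].
have utail n k : rnorm (u (n + k)%N - u n) <= 3 / 2 * (3^-1 ^+ n - 3^-1 ^+ (n + k)).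
  elim: k => [|k IH]; first by rewrite addn0 !subrr rnorm0 mulr0.
  have := rnorm_tri (u (n + k)%N) (u (n + k.+1)%N) (u n).
  by have := ustep (n + k)%N; rewrite addnS exprS; lra.
have c0 n : 0 < 3^-1 ^+ n :> R by rewrite exprn_gt0// invr_gt0.
have utail' n m : (n <= m)%N -> rnorm (u m - u n) <= 3 / 2 * 3^-1 ^+ n.
  by move=> /subnKC <-; have := utail n (m - n)%N; have := c0 (n + (m - n))%N; lra.
have [l ul] : exists l : H, u n @[n --> \oo] --> l.
  apply: rnorm_cauchy_cvg => e e0.
  have e3 : 0 < e / 3 by rewrite divr_gt0.
  have [N NE] := natSinv_small e3.
  exists N => m n Nm Nn.
  have := rnorm_tri (u N) (u m) (u n); rewrite [rnorm (u N - _)]rnorm_dist.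
  have := utail' _ _ Nm; have := utail' _ _ Nn; have := inv3_le N.
  by have := NE N (leqnn N); move: (N.+1%:R^-1) => s; lra.
have ltail n : rnorm (l - u n) <= 3 / 2 * 3^-1 ^+ n.
  apply/ler_addgt0Pr => e e0; have [N NE] := (cvg_rnormP _ _).1 ul e e0.
  have := NE _ (leq_maxl N n); have := utail' _ _ (leq_maxr N n).
  have := rnorm_tri (u (maxn N n)) l (u n).
  by move=> tri h1 h2; rewrite [leRHS]addrC; apply: le_trans tri _; rewrite lerD// ltW.
have [C CP] := ptw l (closed_seq_cvg Mc Mu ul).
pose n := (Num.truncn (2 * `|C|)).+1.
have nC : 2 * `|C| < n%:R by rewrite truncnS_gt.
have lw : 3^-1 ^+ n / 2 * rnorm (w n) <= abs (dot l (w n)).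
  have -> : dot l (w n) = dot (u n.+1) (w n) - dot (u n.+1 - l) (w n).
    by rewrite linearBl /= subKr.
  have := rnorm_tri (dot (u n.+1 - l) (w n) : R[i]^o) (dot (u n.+1) (w n)) 0.
  rewrite !subr0.
  have := rnorm_CS (u n.+1 - l) (w n); rewrite [rnorm (u n.+1 - _)]rnorm_dist.
  have := ltail n.+1; rewrite exprS.
  have := uw n; have := rnorm_ge0 (w n); have := rnorm_ge0 (l - u n.+1).
  move: (3^-1 ^+ n) (rnorm (w n)) (rnorm (l - _)) => c r t; nra.
have wn := (wP n).2; have := CP _ (wP n).1; apply/negP; rewrite -ltNge.
apply: lt_le_trans lw; apply: (@le_lt_trans _ _ `|C|); first exact: ler_norm.
have c3 : 3^-1 ^+ n * 3 ^+ n = 1 :> R by rewrite -exprMn mulVf ?expr1n.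
move: (c0 n) wn c3 nC; move: (3^-1 ^+ n) (3 ^+ n) (rnorm _) => c d r c_gt wn c3 nC.
have : c * (n%:R * d) < c * r by rewrite ltr_pM2l.
by rewrite mulrCA c3; lra.
Qed.

End UniformBoundedness.

(** * Positive operators with closed range *)

Section ClosedRange.
Variables (R : realType) (H : completeNormedModType R[i]) (dot : {dot H for Num.conj}).
Hypothesis H_hilbert : norm_from_dot dot.

Lemma bounded_op_rnorm (L : {linear H -> H}) : bounded_op L ->
  exists2 c : R, 0 < c & forall x, rnorm (L x) <= c * rnorm x.
Proof.
move=> [_ /pos_complexP[c c0 ->] Lc]; exists c => // x.
by rewrite -lecR rmorphM /= !rnormE.
Qed.

(** Preimages in M of a sequence that converges in the image are Cauchy. *)
Lemma closed_image_bounded_below (L : {linear H -> H}) (M : set H) (c : R) :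
  bounded_op L -> closed_subspace M ->
  (forall x, M x -> rnorm x <= c * rnorm (L x)) ->
  closed_subspace (L @` M).
Proof.
move=> /bounded_op_rnorm[d d0 Ld] [Mc M0 MD] cL; split; last 2 first.
- by exists 0; rewrite ?linear0.
- move=> a _ _ [x Mx <-] [y My <-]; exists (a *: x + y); first exact: MD.
  by rewrite linearP.
move=> z /closure_rnormP zL.
have inv0 n : 0 < n.+1%:R^-1 :> R by rewrite invr_gt0.
have /choice[u uP] : forall n, exists x, M x /\ rnorm (z - L x) < n.+1%:R^-1.
  by move=> n; have [_ [x Mx <-] zx] := zL _ (inv0 n); exists x.
have [l ul] : exists l : H, u n @[n --> \oo] --> l.
  apply: rnorm_cauchy_cvg => e e0.
  have c1 : 0 < 2 * (`|c| + 1) by rewrite mulr_gt0// ltr_wpDl.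
  have [|N Ns] := natSinv_small (e := e / (2 * (`|c| + 1))); first by rewrite divr_gt0.
  exists N => m n Nm Nn.
  have Mmn : M (u m - u n).
    by rewrite addrC -scaleN1r; apply: MD; [exact: (uP n).1|exact: (uP m).1].
  have := cL _ Mmn; rewrite linearB.
  have := rnorm_tri z (L (u m)) (L (u n)); rewrite [rnorm (_ - z)]rnorm_dist.
  have := Ns m Nm; have := Ns n Nn; have := (uP m).2; have := (uP n).2.
  rewrite !ltr_pdivlMr//; have := rnorm_ge0 (L (u m) - L (u n)).
  have := ler_norm c; move: c1; move: (m.+1%:R^-1) (n.+1%:R^-1) (`|c|).
  move: (rnorm _) (rnorm _) (rnorm _) (rnorm _) => f a b g s t c'.
  move=> c1 cc g0 bt as_ te se tri le; apply: le_lt_trans le _.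
  nra.
have Ml : M l by apply: closed_seq_cvg Mc _ ul => n; case: (uP n).
exists l => //; apply/eqP; rewrite -subr_eq0; apply/eqP/rnorm0_eq0/eqP.
rewrite eq_le rnorm_ge0 andbT; apply/ler_addgt0Pr => e e0; rewrite add0r.
have e2 : 0 < e / 2 by rewrite divr_gt0.
have [|N1 h1] := (cvg_rnormP _ _).1 ul (e / 2 / d); first by rewrite divr_gt0.
have [N2 h2] := natSinv_small e2; pose n := maxn N1 N2.
have := h1 n (leq_maxl _ _); rewrite ltr_pdivlMr//.
have := h2 n (leq_maxr _ _); have := (uP n).2.
have := rnorm_tri (L (u n)) (L l) z; rewrite [rnorm (L (u n) - z)]rnorm_dist -linearB.
have := Ld (l - u n); move: (n.+1%:R^-1) => s; lra.
Qed.

Variable A : {linear H -> H}.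
Hypothesis A_positive : positive_op dot A.
Hypothesis A_bounded : bounded_op A.
Hypothesis A_closed : closed (range A).
Local Notation "<[ x , y ]>" := (dotA dot A x y).
Local Notation nA := (normA dot A).

Lemma range_subspace : closed_subspace (range A).
Proof.
have := closure_range_subspace A.
by rewrite -(closure_id (range A)).1.
Qed.

Lemma range_ker x : range A x -> A x = 0 -> x = 0.
Proof. by move=> /(@subset_closure _ _)/(closure_range_ker H_hilbert A_positive); apply. Qed.

(** Orthogonal projection onto R(A) does not change the value of A. *)
Lemma exists_range_repr x : exists2 p, range A p & A p = A x.
Proof.
have [m Mm mP] := exists_orth_proj H_hilbert range_subspace x.
exists m => //; apply/esym/eqP; rewrite -subr_eq0 -linearB; apply/eqP.
apply/(closure_range_orth H_hilbert A_positive) => y.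
by rewrite -(closure_id (range A)).1//; exact: mP.
Qed.

(** The inverse of A on its closed range is bounded: for w in R(A) with
    ||A w|| <= 1 and u = A v, the inner product <u, w> = <v, A w> is at most
    ||v||, so the set of these w is weakly bounded on R(A), hence bounded. *)
Lemma range_bounded_below : exists2 c : R, 0 < c &
  forall z, range A z -> rnorm z <= c * rnorm (A z).
Proof.
pose W := [set w | range A w /\ rnorm (A w) <= 1].
have [|u [v _ <-]|c cW] := uniform_boundedness H_hilbert range_subspace (W := W).
- by move=> w [].
- exists (rnorm v) => w [_ Aw]; rewrite (A_selfadjoint A_positive).
  apply: le_trans (rnorm_CS H_hilbert _ _) _.
  by rewrite ler_piMr ?rnorm_ge0.
exists (`|c| + 1); first by rewrite ltr_wpDl.
move=> z Mz; have [->|z0] := eqVneq z 0; first by rewrite linear0 rnorm0 mulr0.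
have Az : 0 < rnorm (A z).
  rewrite lt0r rnorm_ge0 andbT; apply: contraNN z0 => /eqP/rnorm0_eq0.
  by move=> /(range_ker Mz) ->.
have r1 : `|(rnorm (A z))^-1| = (rnorm (A z))^-1 by rewrite gtr0_norm ?invr_gt0.
have := cW ((rnorm (A z))^-1%:C *: z); rewrite rnormZ r1 mulrC ler_pdivrMr//.
move=> /(_ _)/le_trans; apply.
  split; last by rewrite linearZ /= rnormZ r1 mulVf// gt_eqF.
  by have [_ M0 MD] := range_subspace; rewrite -[_ *: _]addr0; exact: MD.
by rewrite ler_wpM2r ?rnorm_ge0// (le_trans (ler_norm c))// lerDl.
Qed.

Lemma normA_le_norm : exists2 k : R[i], 0 < k & forall x, nA x <= k * `|x|.
Proof.
have [a a0 Aa] := A_bounded; exists (sqrtC a); first by rewrite sqrtC_gt0.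
move=> x; rewrite -(@ler_pXn2r _ 2) ?nnegrE ?mulr_ge0 ?normA_ge0 ?sqrtC_ge0 ?(ltW a0)//.
rewrite normA_sq// exprMn sqrtCK -[<[x, x]>]ger0_norm ?dotA_ge0//.
apply: le_trans (dot_CS H_hilbert _ _) _.
by rewrite expr2 mulrA ler_wpM2r.
Qed.

(** ||A x||^2 = <x, A x>_A is at most ||x||_A ||A x||_A. *)
Lemma norm_image_le_normA : exists2 k : R[i], 0 < k & forall x, `|A x| <= k * nA x.
Proof.
have [k k0 nk] := normA_le_norm; exists k => // x.
have [->|Ax0] := eqVneq (A x) 0; first by rewrite normr0 mulr_ge0 ?(ltW k0) ?normA_ge0.
have Ax : 0 < `|A x| by rewrite normr_gt0.
rewrite -(ler_pM2r Ax) -expr2 H_hilbert -[dot _ _]ger0_norm; last first.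
  by rewrite -H_hilbert exprn_ge0.
apply: le_trans (dotA_CS A_positive x (A x)) _.
by rewrite [k * _]mulrC -mulrA ler_wpM2l ?normA_ge0.
Qed.

Lemma norm_le_normA_range :
  exists2 k : R[i], 0 < k & forall z, range A z -> `|z| <= k * nA z.
Proof.
have [c c0 cz] := range_bounded_below; have [k k0 Ak] := norm_image_le_normA.
exists (c%:C * k) => [|z Mz]; first by rewrite mulr_gt0// ltcR.
apply: (@le_trans _ _ (c%:C * `|A z|)).
  by rewrite -!rnormE -rmorphM lecR cz.
by rewrite -mulrA ler_pM2l// ltcR.
Qed.

Lemma normA_congr x y : A x = A y -> nA x = nA y.
Proof.
suff le u v : A u = A v -> nA u <= nA v.
  by move=> e; apply/eqP; rewrite eq_le !le.
move=> e; rewrite -(subrK v u); apply: le_trans (normAD A_positive _ _) _.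
by rewrite normA_ker ?add0r// linearB /= e subrr.
Qed.

Lemma normA_le_norm_image : exists2 k : R[i], 0 < k & forall x, nA x <= k * `|A x|.
Proof.
have [c c0 cz] := range_bounded_below; have [k k0 nk] := normA_le_norm.
exists (k * c%:C) => [|x]; first by rewrite mulr_gt0// ltcR.
have [p Mp px] := exists_range_repr x.
rewrite -(normA_congr px) -px; apply: le_trans (nk p) _.
by rewrite -mulrA ler_pM2l// -!rnormE -rmorphM lecR cz.
Qed.

Variable K : {linear H -> H}.
Hypothesis K_bounded : A_bounded_op dot A K.
Variable d : R[i].
Hypothesis d_gt0 : 0 < d.
Hypothesis K_below : forall x, d * nA x <= nA (K x).

(** K acts on the quotient by N(A) because it is bounded for the A-seminorm, and
    injectively because it is bounded below. *)
Lemma K_bounded_below_ker x : A x = 0 <-> A (K x) = 0.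
Proof.
have [_ [c c0 Kc]] := K_bounded.
split=> [Ax|AKx]; apply: (normA_eq0 A_positive); apply/eqP.
  by rewrite eq_le normA_ge0// andbT (le_trans (Kc x))// normA_ker// mulr0.
rewrite eq_le normA_ge0// andbT -(ler_pM2l d_gt0) mulr0.
by rewrite (le_trans (K_below x))// normA_ker.
Qed.

Lemma AK_linear : linear (A \o K).
Proof. by move=> a x y /=; rewrite !linearP. Qed.

(** On R(A) the chain ||x|| <~ ||x||_A <~ ||K x||_A <~ ||A K x|| bounds A K
    below. *)
Lemma range_AK_closed : closed_subspace ((A \o K) @` range A).
Proof.
pose L : {linear H -> H} := HB.pack (A \o K) (GRing.isLinear.Build _ _ _ _ _ AK_linear).
have [k k0 zk] := norm_le_normA_range; have [k' k'0 xk'] := normA_le_norm_image.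
have [[b b0 Kb] _] := K_bounded; have [a a0 Aa] := A_bounded.
have [c c0 E] : exists2 c : R, 0 < c & k * (d^-1 * k') = c%:C.
  by apply: pos_complexP; rewrite !mulr_gt0// invr_gt0.
have Lb : bounded_op L.
  exists (a * b) => [|x]; first exact: mulr_gt0.
  by apply: le_trans (Aa _) _; rewrite -mulrA ler_pM2l.
apply: (closed_image_bounded_below (c := c) Lb range_subspace) => x Mx.
rewrite -lecR rmorphM /= !rnormE -E; apply: le_trans (zk x Mx) _.
rewrite -!mulrA ler_pM2l// -(ler_pM2l d_gt0) mulVKf ?gt_eqF//.
exact: le_trans (K_below x) (xk' _).
Qed.

(** The A-inverse sends u to the solution x in R(A) of A K x = A u; it is unique
    because R(A) meets N(A) only in 0, hence linear in u, and its bounds come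
    from the lower bound on K. *)
Lemma A_invertible_of_range : range A `<=` (A \o K) @` range A -> A_invertible dot A K.
Proof.
move=> onto; have /choice[s sP] : forall u, exists x, range A x /\ A (K x) = A u.
  by move=> u; have [|x Mx xu] := onto (A u); [exists u | exists x].
have [_ M0 MD] := range_subspace.
have inj x y : range A x -> range A y -> A (K x) = A (K y) -> x = y.
  move=> Mx My e; apply/eqP; rewrite -subr_eq0; apply/eqP/range_ker.
    by rewrite addrC -scaleN1r; exact: MD.
  by apply/K_bounded_below_ker; rewrite !linearB /= e subrr.
have s_linear : linear s.
  move=> a u v; apply: inj; first exact: (sP _).1.
    by apply: MD; [exact: (sP u).1 | exact: (sP v).1].
  by rewrite !linearP /= !(sP _).2 linearP.
pose S : {linear H -> H} := HB.pack s (GRing.isLinear.Build _ _ _ _ _ s_linear).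
have [k k0 zk] := norm_le_normA_range; have [k' k'0 xk'] := normA_le_norm.
have SA u : nA (s u) <= d^-1 * nA u.
  rewrite -(ler_pM2l d_gt0) mulVKf ?gt_eqF//.
  by rewrite -(normA_congr (sP u).2).
exists S; split=> [|u|u].
- split.
    exists (k * (d^-1 * k')) => [|u]; first by rewrite !mulr_gt0 ?invr_gt0.
    apply: le_trans (zk _ (sP u).1) _; rewrite -!mulrA ler_pM2l//.
    by apply: le_trans (SA u) _; rewrite ler_pM2l ?invr_gt0.
  by exists d^-1; rewrite ?invr_gt0.
- exact: (sP u).2.
- apply/eqP; rewrite -subr_eq0 -linearB; apply/eqP/K_bounded_below_ker.
  by rewrite !linearB /= (sP _).2 subrr.
Qed.

(** If some A u is outside the closed range of A K, then its component orthogonal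
    to that range is a vector of R(A), hence has a nonzero seminorm. *)
Lemma A_invertible_or_orth : ~ A_invertible dot A K ->
  exists2 y, nA y = 1 & forall x, <[K x, y]> = 0.
Proof.
move=> ninv.
have [[u Nu]|onto] := pselect (exists u, ~ ((A \o K) @` range A) (A u)); last first.
  case: ninv; apply: A_invertible_of_range => _ [u _ <-].
  by apply: contrapT => Nu; apply: onto; exists u.
have [m Nm mP] := exists_orth_proj H_hilbert range_AK_closed (A u).
have w0 : A u - m != 0.
  by apply/eqP => /eqP; rewrite subr_eq0 => /eqP e; apply: Nu; rewrite e.
have Mw : range A (A u - m).
  by case: Nm => x _ <-; exists (u - K x); rewrite ?linearB.
have nw : 0 < nA (A u - m).
  by apply: (normA_gt0 H_hilbert A_positive _ w0); exact: subset_closure.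
exists ((nA (A u - m))^-1 *: (A u - m)); first exact: normalizeA.
move=> x; rewrite dotAZr /dotA hermC /= expr0 mul1r mP ?rmorph0 ?mulr0//.
have [p Mp px] := exists_range_repr x; exists p => //=.
apply/eqP; rewrite -subr_eq0 -!linearB; apply/eqP/(K_bounded_below_ker _).1.
by rewrite linearB /= px subrr.
Qed.

End ClosedRange.

(** * The A-spectrum when the range is closed *)

Section Spectrum.
Variables (R : realType) (H : completeNormedModType R[i]) (dot : {dot H for Num.conj}).
Hypothesis H_hilbert : norm_from_dot dot.
Variables A T : {linear H -> H}.
Hypothesis A_positive : positive_op dot A.
Hypothesis A_bounded : bounded_op A.
Hypothesis A_closed : closed (range A).
Hypothesis A_rank : dim_ge 2 (range A).
Hypothesis T_bounded : A_bounded_op dot A T.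
Local Notation nA := (normA dot A).

Lemma A_bounded_shift l : A_bounded_op dot A (T \- l \*: idfun).
Proof.
have [[b b0 Tb] [c c0 Tc]] := T_bounded.
split.
  exists (b + `|l|) => [|x]; first by rewrite ltr_wpDr.
  by rewrite mulrDl -normrZ; apply: le_trans (ler_normB _ _) _; rewrite lerD2r.
exists (c + `|l|) => [|x]; first by rewrite ltr_wpDr.
rewrite mulrDl -normAZ// -[nA (l *: x)](normAN A_positive).
by apply: le_trans (normAD A_positive _ _) _; rewrite lerD2r.
Qed.

(** Either T - l has a lower bound for the seminorm, and a vector A-orthogonal
    to its range gives q l as a value, or l has approximate eigenvectors. *)
Lemma spectrum_numerical_range q l : `|q| <= 1 -> A_spectrum dot A T l ->
  closure (A_q_numerical_range dot A q T) (q * l).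
Proof.
move=> q1 ninv.
have [[d d0 below]|nbelow] := pselect
  (exists2 d, 0 < d & forall x, d * nA x <= nA (T x - l *: x)).
  have [y y1 Ky] := A_invertible_or_orth H_hilbert A_positive A_bounded A_closed
     (A_bounded_shift l) d0 below ninv.
  have [|x x1 yx] := exists_inner_productA (q := q^*) A_positive A_rank _ y1.
    by rewrite norm_conjC.
  have xy : dotA dot A x y = q by rewrite dotAC// yx conjCK.
  apply: subset_closure; exists x, y; split=> //.
  have := Ky x; rewrite dotABl dotAZl xy => /eqP; rewrite subr_eq0 => /eqP ->.
  exact: mulrC.
apply: approx_eigen_numerical_range => // e e0; apply: contrapT => nx; apply: nbelow.
exists e => // x; have [->|x0] := eqVneq (nA x) 0; first by rewrite mulr0 normA_ge0.
have xgt : 0 < nA x by rewrite lt0r x0 normA_ge0.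
rewrite -ler_pdivlMr//.
have -> : nA (T x - l *: x) / nA x = nA (T ((nA x)^-1 *: x) - l *: ((nA x)^-1 *: x)).
  rewrite [T (_ *: x)]linearZ /= scalerA [l * _]mulrC -scalerA -scalerBr normAZ//.
  by rewrite gtr0_norm ?invr_gt0// mulrC.
rewrite real_leNgt ?ger0_real ?normA_ge0 ?(ltW e0)//; apply/negP => lt.
by apply: nx; exists ((nA x)^-1 *: x) => //; exact: normalizeA.
Qed.

End Spectrum.

(** * The inclusions of spectra *)

Theorem proposition2p1 (R : realType) (H : completeNormedModType R[i])
    (dot : {dot H for Num.conj})
    (H_hilbert : norm_from_dot dot)
    (H_separable : separable_space H)
    (H_infdim : infinite_dimensional H)
    (A : {linear H -> H})
    (A_bounded : bounded_op A)
    (A_positive : positive_op dot A)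
    (A_rank : dim_ge 2 (range A))
    (T : {linear H -> H})
    (T_bounded : A_bounded_op dot A T)
    (q : R[i])
    (q_disk : `|q| <= 1) :
  [/\ [set q * l | l in A_point_spectrum dot A T]
        `<=` A_q_numerical_range dot A q T,
      [set q * l | l in A_approx_point_spectrum dot A T]
        `<=` closure (A_q_numerical_range dot A q T)
    & closed (range A) ->
      [set q * l | l in A_spectrum dot A T]
        `<=` closure (A_q_numerical_range dot A q T)].
Proof.
split=> [_ [l lT <-]|_ [l lT <-]|A_closed _ [l lT <-]].
- exact: point_spectrum_numerical_range.
- exact: approx_point_spectrum_numerical_range.
- exact: spectrum_numerical_range.
Qed.
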